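(* Let $n$ be a positive integer. A profile $P=(x^{(1)},x^{(2)},x^{(3)},x^{(4)})$ of four players on $Q_n=\{0,1\}^n$ is an equilibrium if and only if it is balanced.
   Context: Let $Q_n=\{0,1\}^n$ and let $d(x,y)=\sum_{j=1}^n|x_j-y_j|$ be the Hamming distance on $Q_n$. A profile of four players $A_1,\dots,A_4$ on $Q_n$ is a tuple $P=(x^{(1)},x^{(2)},x^{(3)},x^{(4)})$ with each $x^{(i)}\in Q_n$ (the position of player $A_i$; positions need not be distinct). Player $A_i$ claims $x\in Q_n$ in $P$ if $d(x,x^{(i)})\le d(x,x^{(j)})$ for all $j\in\{1,2,3,4\}$. Let $t_P(x)$ be the number of players that claim $x$ in $P$, and let $V_P(A_i)=\{x\in Q_n: A_i\text{ claims }x\text{ in }P\}$ be the Voronoi cell of $A_i$. The score of $A_i$ in $P$ is $\sigma_P(A_i)=2^{-n}\sum_{x\in V_P(A_i)}\frac{1}{t_P(x)}$. The profile $P$ is an equilibrium if for every $i\in\{1,2,3,4\}$ and every profile $P'$ obtained from $P$ by replacing $x^{(i)}$ by an arbitrary point of $Q_n$ (the other three positions unchanged), $\sigma_P(A_i)\ge\sigma_{P'}(A_i)$. The profile $P$ is balanced if for every coordinate $j\in\{1,\dots,n\}$, $x^{(i)}_j=0$ for exactly two values of $i\in\{1,2,3,4\}$ (and hence $x^{(i)}_j=1$ for the other two). *)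

(* Defs.v *)
From mathcomp Require Import all_boot all_order all_algebra.

Set Implicit Arguments.
Unset Strict Implicit.
Unset Printing Implicit Defensive.

Import Order.TTheory GRing.Theory Num.Theory.

Local Open Scope ring_scope.

(* The coordinates 0 and 1 are the booleans false and true. *)
Definition cube (n : nat) : finType := {ffun 'I_n -> bool}.

(* Each coordinate is coerced from bool to nat to int before subtracting. *)
Definition hamming (n : nat) (x y : cube n) : nat :=
  (\sum_(j < n) `|(x j)%:Z - (y j)%:Z|)%N.

Definition profile (n : nat) : finType := {ffun 'I_4 -> cube n}.

Definition claims (n : nat) (P : profile n) (i : 'I_4) (x : cube n) : bool :=
  [forall k : 'I_4, (hamming x (P i) <= hamming x (P k))%N].

Definition num_claims (n : nat) (P : profile n) (x : cube n) : nat :=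
  #|[set i : 'I_4 | claims P i x]|.

Definition voronoi (n : nat) (P : profile n) (i : 'I_4) : {set cube n} :=
  [set x : cube n | claims P i x].

(* All scores are rational numbers. *)
Definition score (n : nat) (P : profile n) (i : 'I_4) : rat :=
  2 ^- n * \sum_(x in voronoi P i) 1 / (num_claims P x)%:R.

Definition equilibrium (n : nat) (P : profile n) : Prop :=
  forall (i : 'I_4) (P' : profile n),
    (forall k : 'I_4, k != i -> P' k = P k) -> score P i >= score P' i.

Definition balanced (n : nat) (P : profile n) : Prop :=
  forall j : 'I_n, #|[set i : 'I_4 | P i j == false]| = 2%N.

(* Main.v *)
Require Import Defs.
From mathcomp Require Import all_boot all_order all_algebra.
From mathcomp Require Import ring lra zify.

(** Fix a player at [y] facing three opponents.  Reading a voter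
relative to [y] turns its coordinates into independent fair signs, and the
leads of [y] over the opponents (the differences of distances) become sums
X, Y, W of the signs over the coordinates where the respective opponent differs
from [y].  The antipode of a voter negates all three leads.  Averaging the share
of [y] over a voter and its antipode therefore kills the odd part and leaves
only pair interactions: this average is 1/8 plus 1/8 of
tau(X,Y) + tau(X,W) + tau(Y,W), where
tau(u,v) = sgn u * sgn v + [u = v = 0]/3 (lemma [share_sym]).  Hence
the score of [y] is 1/8 plus 1/8 of a sum of three pair terms (lemma
[score_cube_pair_term]); each is the expectation of tau(R+S, R+T) for independent
walks R, S, T whose lengths count the coordinates where both opponents differ
from [y], only the first does, only the second does.

Let p, q, r count the coordinates where [y] agrees with exactly one opponent
(the first, second, third respectively), and let a, b, c count those where
exactly one opponent differs from [y].  Three facts about such sums carry the proof.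

- If a = b = c = 0 and the opponents never all differ from [y], the three pair
  terms sum to 1, so the score is exactly 1/4:
  flipping two of the three walks permutes the roles of the four players, and
  the sum over the four sign patterns is constant (lemma
  [signsum_tau3]).

- If no coordinate is unanimous among the opponents, the sum is at most 1 (lemma
  [triple_term_le1]).  Two coordinates of the same kind among a, b, c can be
  removed without decreasing the sum, because walks are unimodal and the leads
  are positively correlated (lemma [pair_term_add2]).  Once each kind
  occurs at most once, they can be removed one at a time, by an inequality that
  holds pointwise after averaging over the sign of one walk
  (lemma [loss_sym_ge0]).

- If a = b = c = 0 and in addition there is one coordinate where all three
  opponents differ from [y], the sum exceeds 1 (lemma
  [triple_term_succ_gt1]).

A player can always move to the minority value in every coordinate where the
opponents disagree, and can use one unanimous coordinate, if there is one, in
the way of the third fact.  So in an equilibrium every score is at least 1/4,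
and a player whose opponents are unanimous somewhere gets more.  Scores sum to
1, so no three players agree in any coordinate, and every coordinate splits the
players two against two.  Conversely in a balanced profile everybody has 1/4
by the first fact, and no three players are unanimous anywhere, so by
the second fact no deviation gains. *)

Set Implicit Arguments.
Unset Strict Implicit.
Unset Printing Implicit Defensive.

Import Order.TTheory GRing.Theory Num.Theory.

Local Open Scope ring_scope.

(** * Signs of integers and the kernel tau *)

Definition sg (a : int) : rat := (Num.sg a)%:~R.
Definition nul (a : int) : rat := (a == 0)%:R.

(** The correction at [u = v = 0] is what equal tie splitting contributes: a voter tied
between the player and one, two or three opponents gives 1/2, 1/3, 1/4, while
a factor 1/2 for each tied opponent would give 1/2, 1/4, 1/8. *)
Definition tau (a b : int) : rat := sg a * sg b + nul a * nul b / 3.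

(** Both indicators are abstracted at once, so that a case analysis on the sign of
[a] turns a goal about [tau] into one about rational constants. *)
Variant sign_spec (a : int) : rat -> rat -> Prop :=
| SignNeg of a < 0 : sign_spec a (-1) 0
| SignZero of a = 0 : sign_spec a 0 1
| SignPos of 0 < a : sign_spec a 1 0.

Lemma signP a : sign_spec a (sg a) (nul a).
Proof.
rewrite /sg /nul; case: (ltrgtP a 0) => [h|h|->].
- by rewrite ltr0_sg // ; constructor.
- by rewrite gtr0_sg //; constructor.
- by rewrite sgr0; constructor.
Qed.

(** Case analysis on the signs of all the linear forms in the goal; [lia] discards the
sign patterns that no integer point realizes, which keeps the number of cases small. *)
Ltac signs := repeat match goal with
  | |- context [sg ?a] => case: (signP a) => ?; try (exfalso; lia)
  | |- context [nul ?a] => case: (signP a) => ?; try (exfalso; lia)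
  end.

Lemma sgN a : sg (- a) = - sg a.
Proof. by rewrite /sg sgrN rmorphN. Qed.

Lemma nulN a : nul (- a) = nul a.
Proof. by rewrite /nul oppr_eq0. Qed.

Lemma tauN a b : tau (- a) (- b) = tau a b.
Proof. by rewrite /tau !sgN !nulN mulrNN. Qed.

Lemma tauC a b : tau a b = tau b a.
Proof. by rewrite /tau mulrC [nul a * _]mulrC. Qed.

(** * Symmetric random walks *)

(** Expectation of [f] at the position of a symmetric walk after [n] steps. *)
Fixpoint walk (n : nat) (f : int -> rat) : rat :=
  if n is m.+1 then (walk m (fun x => f (x + 1)) + walk m (fun x => f (x - 1))) / 2
  else f 0.

Lemma eq_walk n f g : f =1 g -> walk n f = walk n g.
Proof. by elim: n f g => [|n IH] f g e /=; rewrite ?e // !(IH _ _ (fun x => e _)). Qed.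

Lemma walkD n f g : walk n (fun x => f x + g x) = walk n f + walk n g.
Proof. by elim: n f g => [|n IH] f g //=; rewrite !IH; field. Qed.

Lemma walkZ n c f : walk n (fun x => c * f x) = c * walk n f.
Proof. by elim: n f => [|n IH] f //=; rewrite !IH; field. Qed.

Lemma walk_const n c : walk n (fun=> c) = c.
Proof. by elim: n => [|n IH] //=; rewrite IH; field. Qed.

Lemma walk_ge0 n f : (forall x, 0 <= f x) -> 0 <= walk n f.
Proof.
elim: n f => [|n IH] f h //=.
by rewrite divr_ge0 // addr_ge0 // IH.
Qed.

Lemma walk_opp n f : walk n (fun x => f (- x)) = walk n f.
Proof.
elim: n f => [|n IH] f /=; first by rewrite oppr0.
rewrite addrC -(IH (fun x => f (x + 1))) -(IH (fun x => f (x - 1))).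
by congr (_ / _); congr (_ + _); apply: eq_walk => x; congr f; lia.
Qed.

(** Symmetrization: the walk is distributed as its opposite. *)
Lemma walk_ge0_sym n f : (forall x, 0 <= f x + f (- x)) -> 0 <= walk n f.
Proof.
move=> h; suff : 0 <= walk n f + walk n f by lra.
by rewrite -{2}walk_opp -walkD walk_ge0.
Qed.

Lemma walkC m n (F : int -> int -> rat) :
  walk m (fun x => walk n (F x)) = walk n (fun y => walk m (F^~ y)).
Proof.
elim: m F => [|m IH] F //=; rewrite !IH.
by rewrite -walkD mulrC -walkZ; apply: eq_walk => y; field.
Qed.

Lemma walk_avg n f g : walk n (fun x => (f x + g x) / 2) = (walk n f + walk n g) / 2.
Proof. by rewrite -walkD mulrC -walkZ; apply: eq_walk => x; rewrite mulrC. Qed.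

Lemma walkS n f : walk n.+1 f = walk n (fun x => (f (x + 1) + f (x - 1)) / 2).
Proof. by rewrite walk_avg. Qed.

(** * Unimodality of the walk distribution *)

(** Monotonicity in the absolute value, within each parity class separately,
because a walk lives on one parity class; evenness is the case |a| = |b|. *)
Definition unimodal (h : int -> rat) : Prop :=
  forall a b : int, `|a| <= `|b| -> (2 %| a - b)%Z -> h b <= h a.

(** Averaging [h (c - 1)] and [h (c + 1)] preserves unimodality: increasing |c|
by an even amount increases (weakly) both | |c| - 1 | and |c| + 1. *)
Lemma unimodal_walk n h :
  unimodal h -> unimodal (fun c => walk n (fun x => h (c - x))).
Proof.
move=> uh; elim: n => [|n IH] a b ab e; first by rewrite /= !subr0; apply: uh.
have hN c : h (- c) = h c.
  by apply/eqP; rewrite eq_le; apply/andP; split; apply: uh; lia.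
have cN c : walk n (fun x => h (- c - x)) = walk n (fun x => h (c - x)).
  by rewrite -walk_opp; apply: eq_walk => x; rewrite -hN; congr h; lia.
have eS c : walk n.+1 (fun x => h (c - x)) =
   (walk n (fun x => h (`|c| + 1 - x)) + walk n (fun x => h (`|c| - 1 - x))) / 2.
  rewrite /=; case: (ger0P c) => hc.
    by rewrite addrC; congr ((_ + _) / _); apply: eq_walk => x; congr h; lia.
  have -> : - c + 1 = - (c - 1) by lia.
  have -> : - c - 1 = - (c + 1) by lia.
  by rewrite !cN; congr ((_ + _) / _); apply: eq_walk => x; congr h; lia.
rewrite !eS ler_pM2r // lerD // IH; lia.
Qed.

Lemma unimodal_nul : unimodal nul.
Proof. by move=> a b ab e; case: (signP a); case: (signP b) => // hb ha; lia. Qed.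

Lemma unimodal_ge0M f g : (forall x, 0 <= f x) -> (forall x, 0 <= g x) ->
  unimodal f -> unimodal g -> unimodal (fun x => f x * g x).
Proof. by move=> f0 g0 uf ug a b ab e; rewrite ler_pM // ?uf ?ug. Qed.

(** Probability that the walk is at [c] after [n] steps. *)
Definition mass n (c : int) : rat := walk n (fun x => nul (c - x)).

Lemma mass_ge0 n c : 0 <= mass n c.
Proof. by apply: walk_ge0 => x; rewrite /nul ler0n. Qed.

Lemma unimodal_mass n : unimodal (mass n).
Proof. exact/unimodal_walk/unimodal_nul. Qed.

Lemma massN n c : mass n (- c) = mass n c.
Proof. by apply/eqP; rewrite eq_le !unimodal_mass //; lia. Qed.

Lemma mass_odd_gt0 n : 0 < mass n (odd n)%:Z.
Proof.
elim: n => [|n IH]; first by [].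
have -> : mass n.+1 (odd n.+1) = (mass n ((odd n.+1)%:Z - 1) + mass n ((odd n.+1)%:Z + 1)) / 2.
  by rewrite /mass /=; congr ((_ + _) / _); apply: eq_walk => x; congr nul; lia.
rewrite divr_gt0 //=; case: (odd n) IH => h /=.
  by rewrite ltr_wpDl // mass_ge0.
by rewrite ltr_wpDr // mass_ge0.
Qed.

Lemma walk_mass n c (f : int -> rat) : walk n (fun x => nul (c - x) * f x) = mass n c * f c.
Proof.
rewrite mulrC -walkZ; apply: eq_walk => x.
by case: signP => h; rewrite ?mul0r ?mulr0 // mul1r mulr1; congr f; lia.
Qed.

(** * Three independent walks *)

Definition walk3 p q r (F : int -> int -> int -> rat) : rat :=
  walk p (fun x => walk q (fun y => walk r (F x y))).

Lemma eq_walk3 p q r F G : (forall x y z, F x y z = G x y z) ->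
  walk3 p q r F = walk3 p q r G.
Proof. by move=> e; do 3 apply: eq_walk => ?; apply: e. Qed.

Lemma walk3D p q r F G :
  walk3 p q r (fun x y z => F x y z + G x y z) = walk3 p q r F + walk3 p q r G.
Proof.
rewrite /walk3 -walkD; apply: eq_walk => x; rewrite -walkD; apply: eq_walk => y.
exact: walkD.
Qed.

Lemma walk3Z p q r c F :
  walk3 p q r (fun x y z => c * F x y z) = c * walk3 p q r F.
Proof.
rewrite /walk3 -walkZ; apply: eq_walk => x; rewrite -walkZ; apply: eq_walk => y.
exact: walkZ.
Qed.

Lemma walk3_const p q r c : walk3 p q r (fun _ _ _ => c) = c.
Proof. by rewrite /walk3 !walk_const. Qed.

Lemma walk3_ge0 p q r F : (forall x y z, 0 <= F x y z) -> 0 <= walk3 p q r F.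
Proof. by move=> h; do 3 apply: walk_ge0 => ?; apply: h. Qed.

Lemma walk3_swap12 p q r F : walk3 p q r F = walk3 q p r (fun y x z => F x y z).
Proof. exact: walkC. Qed.

Lemma walk3_swap23 p q r F : walk3 p q r F = walk3 p r q (fun x z y => F x y z).
Proof. by apply: eq_walk => x; apply: walkC. Qed.

Lemma walk3_opp1 p q r F : walk3 p q r (fun x y z => F (- x) y z) = walk3 p q r F.
Proof. exact: (walk_opp p (fun x => walk q (fun y => walk r (F x y)))). Qed.

Lemma walk3_opp2 p q r F : walk3 p q r (fun x y z => F x (- y) z) = walk3 p q r F.
Proof. by apply: eq_walk => x; apply: (walk_opp q (fun y => walk r (F x y))). Qed.

Lemma walk3S1 p q r F : walk3 p.+1 q r F =
  walk3 p q r (fun x y z => (F (x + 1) y z + F (x - 1) y z) / 2).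
Proof.
rewrite /walk3 walkS; apply: eq_walk => x; rewrite -walk_avg.
by apply: eq_walk => y; rewrite walk_avg.
Qed.

Lemma walk3S2 p q r F : walk3 p q.+1 r F =
  walk3 p q r (fun x y z => (F x (y + 1) z + F x (y - 1) z) / 2).
Proof. by rewrite walk3_swap12 walk3S1 walk3_swap12. Qed.

Lemma walk3S3 p q r F : walk3 p q r.+1 F =
  walk3 p q r (fun x y z => (F x y (z + 1) + F x y (z - 1)) / 2).
Proof. by rewrite walk3_swap23 walk3S2 walk3_swap23. Qed.

(** It suffices to check an inequality after symmetrizing the first walk; this
removes the cases where the integrand alone is negative. *)
Lemma walk3_ge0_sym p q r F :
  (forall x y z, 0 <= F x y z + F (- x) y z) -> 0 <= walk3 p q r F.
Proof.
move=> h; suff : 0 <= walk3 p q r F + walk3 p q r F by lra.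
by rewrite -{2}walk3_opp1 -walk3D walk3_ge0.
Qed.

Lemma walk3_opp p q r F :
  walk3 p q r (fun x y z => F (- x) (- y) (- z)) = walk3 p q r F.
Proof.
rewrite (walk3_opp1 p q r (fun x y z => F x (- y) (- z))).
rewrite (walk3_opp2 p q r (fun x y z => F x y (- z))).
by do 2 apply: eq_walk => ?; rewrite walk_opp.
Qed.

Lemma walk3_lin p q r c F G :
  walk3 p q r (fun x y z => F x y z + c * G x y z) =
  walk3 p q r F + c * walk3 p q r G.
Proof. by rewrite walk3D walk3Z. Qed.

Lemma walk3_mul p q r f g h :
  walk3 p q r (fun x y z => f x * (g y * h z)) = walk p f * (walk q g * walk r h).
Proof.
have walkZr n c k : walk n (fun x => k x * c) = walk n k * c.
  by rewrite mulrC -walkZ; apply: eq_walk => x; rewrite mulrC.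
rewrite -walkZr; apply: eq_walk => x; rewrite -walkZr -walkZ; apply: eq_walk => y.
by rewrite !walkZ.
Qed.

Lemma walk3_avg p q r F G :
  (walk3 p q r F + walk3 p q r G) / 2 =
  walk3 p q r (fun x y z => (F x y z + G x y z) / 2).
Proof.
rewrite mulrC -walk3D -walk3Z; apply: eq_walk3 => x y z; exact: mulrC.
Qed.

(** Adding at most one step is written as an average over its sign also when no
step is added, so that both cases share one formula. *)
Lemma walk3_addb p q r (b : bool) F : walk3 (p + b) q r F =
  walk3 p q r (fun x y z => (F (x + b%:Z) y z + F (x - b%:Z) y z) / 2).
Proof.
case: b => /=; first by rewrite addn1 walk3S1.
rewrite addn0; apply: eq_walk3 => x y z.
have -> : x + 0%:Z = x by lia.
by field.
Qed.

(** * The pair term and its monotonicity in steps of two *)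

(** Expectation of [tau] at two leads with [r] common coordinates and [s], [t]
coordinates of their own. *)
Definition pair_term (r s t : nat) : rat := walk3 r s t (fun x y z => tau (x + y) (x + z)).

Lemma pair_termC r s t : pair_term r s t = pair_term r t s.
Proof. by rewrite /pair_term walk3_swap23; apply: eq_walk3 => *; apply: tauC. Qed.

(** Conditional expectation of the sign of the second lead, given the walk shared
by both leads. *)
Definition drift t (x : int) : rat := walk t (fun z => sg (x + z)).

Lemma driftN t x : drift t (- x) = - drift t x.
Proof.
rewrite /drift -walk_opp -[RHS]mulN1r -walkZ; apply: eq_walk => z.
by rewrite mulN1r -sgN opprD.
Qed.

Lemma drift_ge0 t x : 0 <= x -> 0 <= drift t x.
Proof.
move=> x0; apply: walk_ge0_sym => z.
by case: (signP (x + z)); case: (signP (x - z)) => //; lia.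
Qed.

(** Expectation of the sign of the second lead on the event that the first is [c]. *)
Definition corr r s t c : rat :=
  walk3 r s t (fun x y z => nul (c - (x + y)) * sg (x + z)).

(** The leads are positively correlated: given that the sum of the shared walk and the
proper walk of the first lead is [c >= 0], the values [x] and [- x] of the shared
walk compare by unimodality of the proper walk, and the drift is odd and nonnegative
on nonnegative values. *)
Lemma corr_ge0 r s t c : 0 <= c -> 0 <= corr r s t c.
Proof.
move=> c0.
have -> : corr r s t c = walk r (fun x => mass s (c - x) * drift t x).
  apply: eq_walk => x; rewrite mulrC -walkZ; apply: eq_walk => y.
  by rewrite walkZ mulrC opprD addrA.
apply: walk_ge0_sym => x; rewrite driftN mulrN -mulrBl.
have [x0|x0] := lerP 0 x.
  by rewrite mulr_ge0 ?drift_ge0 // subr_ge0 unimodal_mass; lia.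
have d0 : drift t x <= 0 by rewrite -oppr_ge0 -driftN drift_ge0; lia.
by rewrite mulr_le0 // subr_le0 unimodal_mass; lia.
Qed.

Lemma corrN r s t c : corr r s t (- c) = - corr r s t c.
Proof.
rewrite /corr -walk3_opp -[RHS]mulN1r -walk3Z; apply: eq_walk3 => x y z.
by rewrite mulN1r -mulrN -sgN -nulN; congr (nul _ * sg _); lia.
Qed.

(** Probability that the first lead is [c] and the second is tied. *)
Definition joint r s t c : rat :=
  walk3 r s t (fun x y z => nul (c - (x + y)) * nul (x + z)).

(** Given its proper walk [y], the first lead is [c] and the second is 0 when the shared
walk is at [c - y] and the proper walk of the second lead at its opposite;
so this is the convolution of the product of two unimodal functions with a walk. *)
Lemma unimodal_joint r s t : unimodal (joint r s t).
Proof.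
have e c : joint r s t c = walk s (fun y => mass r (c - y) * mass t (c - y)).
  rewrite /joint walk3_swap12; apply: eq_walk => y.
  rewrite -walk_mass; apply: eq_walk => x; rewrite walkZ.
  have -> : c - (x + y) = c - y - x by lia.
  case: (signP (c - y - x)) => h; rewrite ?mul0r // !mul1r.
  rewrite -massN; apply: eq_walk => z; rewrite -nulN; congr nul; lia.
move=> a b ab d; rewrite !e.
apply: (unimodal_walk s (h := fun x => mass r x * mass t x)) => //.
by apply: unimodal_ge0M; by [apply: mass_ge0|apply: unimodal_mass].
Qed.

Lemma jointN r s t c : joint r s t (- c) = joint r s t c.
Proof. by apply/eqP; rewrite eq_le !unimodal_joint //; lia. Qed.

(** Two more steps of the first lead replace [tau X w] by the average with weights
1/4, 1/2, 1/4 over [X + 2], [X], [X - 2].  Only the values of [X] within 2 of the origin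
contribute to the change, whose terms have the right sign by [corr_ge0] and
[unimodal_joint]. *)
Lemma pair_term_add2 r s t : pair_term r s.+2 t <= pair_term r s t.
Proof.
have -> : pair_term r s.+2 t =
    walk3 r s t (fun x y z => (tau (x + y + 2) (x + z) +
      tau (x + y - 2) (x + z) + 2 * tau (x + y) (x + z)) / 4).
  rewrite /pair_term !walk3S2; apply: eq_walk3 => x y z.
  have -> : x + (y + 1 + 1) = x + y + 2 by lia.
  have -> : x + (y + 1 - 1) = x + y by lia.
  have -> : x + (y - 1 + 1) = x + y by lia.
  have -> : x + (y - 1 - 1) = x + y - 2 by lia.
  by field.
(* The change of [tau] is tabulated by the value of the first lead, one indicator
   per value -2, -1, 0, 1, 2. *)
have -> : walk3 r s t (fun x y z => (tau (x + y + 2) (x + z) +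
      tau (x + y - 2) (x + z) + 2 * tau (x + y) (x + z)) / 4) =
    walk3 r s t (fun x y z => tau (x + y) (x + z)
      + - (1/2) * (nul (1 - (x + y)) * sg (x + z))
      + 1/2 * (nul (-1 - (x + y)) * sg (x + z))
      + - (1/4) * (nul (2 - (x + y)) * sg (x + z))
      + 1/4 * (nul (-2 - (x + y)) * sg (x + z))
      + 1/12 * (nul (2 - (x + y)) * nul (x + z))
      + 1/12 * (nul (-2 - (x + y)) * nul (x + z))
      + - (1/6) * (nul (0 - (x + y)) * nul (x + z))).
  apply: eq_walk3 => x y z; rewrite /tau; move: (x + y) (x + z) => X w.
  have [h|[h|[h|[h|[h|h]]]]] :
      (X = -2 \/ X = -1 \/ X = 0 \/ X = 1 \/ X = 2 \/ (2 < `|X|)) by lia.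
  1-5: by rewrite h; signs; field.
  by signs; field.
do 7 rewrite walk3_lin.
rewrite -/(pair_term r s t) -/(corr r s t 1) -/(corr r s t (-1)) -/(corr r s t 2).
rewrite -/(corr r s t (-2)) -/(joint r s t 2) -/(joint r s t (-2)) -/(joint r s t 0).
rewrite (corrN _ _ _ 1) (corrN _ _ _ 2) (jointN _ _ _ 2).
have h1 := @corr_ge0 r s t 1 isT; have h2 := @corr_ge0 r s t 2 isT.
have : joint r s t 2 <= joint r s t 0 by apply: unimodal_joint.
lra.
Qed.

(** * The score of a player who agrees with exactly one opponent everywhere *)

(** For a player whose opponents never all differ from it in one coordinate: eight times
its score, minus one, if it agrees with exactly one opponent in [p], [q], [r]
coordinates and differs from exactly one in [a], [b], [c] coordinates (the first,
second and third opponent respectively). *)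
Definition triple_term p q r a b c : rat :=
  pair_term r (q + a) (p + b) + pair_term q (r + a) (p + c) + pair_term p (r + b) (q + c).

Lemma triple_term_swap12 p q r a b c : triple_term p q r a b c = triple_term q p r b a c.
Proof. by rewrite /triple_term (pair_termC r) -addrA [pair_term q _ _ + _]addrC addrA. Qed.

Lemma triple_term_swap23 p q r a b c : triple_term p q r a b c = triple_term p r q a c b.
Proof. by rewrite /triple_term (pair_termC p) [pair_term r _ _ + _]addrC. Qed.

Definition tau3 (x y z : int) : rat :=
  tau (y + z) (x + z) + tau (y + z) (x + y) + tau (x + z) (x + y).

(** Sum over the sign changes of three walks modulo the global one, under which all
integrands below are invariant. *)
Definition signsum (F : int -> int -> int -> rat) (x y z : int) : rat :=
  F x y z + F (- x) y z + F x (- y) z + F (- x) (- y) z.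

Lemma walk3_signsum p q r F : walk3 p q r (signsum F) = 4 * walk3 p q r F.
Proof.
rewrite /signsum !walk3D walk3_opp1 walk3_opp2.
rewrite (walk3_opp1 p q r (fun x y z => F x (- y) z)) walk3_opp2; ring.
Qed.

Lemma pair_term_walk3 p q r : pair_term r q p = walk3 p q r (fun x y z => tau (y + z) (x + z)).
Proof.
rewrite /pair_term walk3_swap12 walk3_swap23 walk3_swap12.
by apply: eq_walk3 => x y z; rewrite !(addrC z).
Qed.

Lemma triple_term_walk3 p q r : triple_term p q r 0 0 0 = walk3 p q r tau3.
Proof.
rewrite /triple_term !addn0 /tau3 2!walk3D; congr (_ + _ + _).
- exact: pair_term_walk3.
- rewrite pair_term_walk3 walk3_swap23.
  by apply: eq_walk3 => x y z; rewrite (addrC y).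
rewrite pair_term_walk3 walk3_swap12 walk3_swap23 walk3_swap12.
by rewrite walk3_swap23; apply: eq_walk3 => x y z; rewrite (addrC z) (addrC y).
Qed.

(** The four sign patterns are the points of view of the four players on one voter
and its antipode, and the shares of a voter sum to 1. *)
Lemma signsum_tau3 x y z : signsum tau3 x y z = 4.
Proof.
rewrite /signsum /tau3 /tau.
have e1 : - x + z = - (x - z) by lia.
have e2 : - x + - y = - (x + y) by lia.
have e3 : - x + y = - (x - y) by lia.
have e4 : - y + z = - (y - z) by lia.
by rewrite e1 e2 e3 e4 ?sgN ?nulN; signs; field.
Qed.

Lemma triple_term000 p q r : triple_term p q r 0 0 0 = 1.
Proof.
suff : 4 * triple_term p q r 0 0 0 = 4 by lra.
rewrite triple_term_walk3 -walk3_signsum -[RHS](walk3_const p q r).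
exact/eq_walk3/signsum_tau3.
Qed.

(** * Removing coordinates where only one opponent differs *)

(** The coordinates where only the first opponent differs enter the two pair terms
that involve this opponent, always as proper coordinates. *)
Lemma triple_term_add2 p q r a b c : triple_term p q r a.+2 b c <= triple_term p q r a b c.
Proof. by rewrite /triple_term !addnS 2?lerD ?pair_term_add2. Qed.

(** Decrease of [tau] when the first lead receives one more independent step. *)
Definition loss (X w : int) : rat := tau X w - (tau (X + 1) w + tau (X - 1) w) / 2.

Lemma pair_term_loss p q r (b : bool) :
  pair_term r q (p + b) - pair_term r q.+1 (p + b) = walk3 p q r (fun x y z =>
    (loss (y + z) (x + b%:Z + z) + loss (y + z) (x - b%:Z + z)) / 2).
Proof.
rewrite !pair_term_walk3 walk3S2 !walk3_addb -[X in _ - X]mul1r -mulNr -walk3_lin.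
apply: eq_walk3 => x y z; rewrite /loss.
have -> : y + 1 + z = y + z + 1 by lia.
have -> : y - 1 + z = y + z - 1 by lia.
by field.
Qed.

Lemma loss_at0 w : 0 <= loss 0 w.
Proof. by rewrite /loss /tau; signs. Qed.

Lemma loss_at1 w : loss 1 w = (sg w - nul w / 3) / 2.
Proof. by rewrite /loss /tau; signs; field. Qed.

Lemma loss_atN1 w : loss (-1) w = (- sg w - nul w / 3) / 2.
Proof. by rewrite /loss /tau; signs; field. Qed.

Lemma loss_far X w : 1 < `|X| -> loss X w = 0.
Proof. by move=> h; rewrite /loss /tau; signs; field. Qed.

(** Up to a constant factor, the total loss at lead 1, grouped by the variable
[x + y] or [y - x] on which each half depends once [z = 1 - y] is substituted. *)
Definition edge_loss (b c k : int) : rat :=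
  (sg (1 - k + b) - nul (1 - k + b) / 3) + (sg (1 - k - b) - nul (1 - k - b) / 3)
  + (sg (k + c) - nul (k + c) / 3) + (sg (k - c) - nul (k - c) / 3).

Lemma edge_loss_ge0 b c k : 0 <= b <= 1 -> 0 <= c <= 1 -> 0 <= edge_loss b c k.
Proof. by move=> hb hc; rewrite /edge_loss; signs; lra. Qed.

(** The first lead is [y + z].  There is no loss when it is far from 0, and a nonnegative
one when it is 0.  At 1 or -1 the loss may be negative for a given [x], but the terms
from [x] and [- x] regroup into two values of [edge_loss]. *)
Lemma loss_sym_ge0 (b c x y z : int) : 0 <= b <= 1 -> 0 <= c <= 1 ->
  let D x := (loss (y + z) (x + b + z) + loss (y + z) (x - b + z)) / 2 +
    (loss (y + z) (x + c + y) + loss (y + z) (x - c + y)) / 2 in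
  0 <= D x + D (- x).
Proof.
move=> hb hc; rewrite /=; have [h|[h|[h|h]]] :
  (y + z = 0 \/ y + z = 1 \/ y + z = -1 \/ 1 < `|y + z|) by lia.
- rewrite h.
  have := loss_at0 (x + b + z); have := loss_at0 (x - b + z).
  have := loss_at0 (x + c + y); have := loss_at0 (x - c + y).
  have := loss_at0 (- x + b + z); have := loss_at0 (- x - b + z).
  have := loss_at0 (- x + c + y); have := loss_at0 (- x - c + y); lra.
- have -> : z = 1 - y by lia.
  have -> : y + (1 - y) = 1 by lia.
  rewrite !loss_at1.
  have -> : x + b + (1 - y) = 1 - (y - x) + b by lia.
  have -> : x - b + (1 - y) = 1 - (y - x) - b by lia.
  have -> : - x + b + (1 - y) = 1 - (x + y) + b by lia.
  have -> : - x - b + (1 - y) = 1 - (x + y) - b by lia.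
  have -> : x + c + y = x + y + c by lia.
  have -> : x - c + y = x + y - c by lia.
  have -> : - x + c + y = y - x + c by lia.
  have -> : - x - c + y = y - x - c by lia.
  have := edge_loss_ge0 (x + y) hb hc; have := edge_loss_ge0 (y - x) hb hc.
  by rewrite /edge_loss; lra.
- have -> : z = - 1 - y by lia.
  have -> : y + (- 1 - y) = - 1 by lia.
  have -> : x + b + (- 1 - y) = - (1 - (x - y) - b) by lia.
  have -> : x - b + (- 1 - y) = - (1 - (x - y) + b) by lia.
  have -> : - x + b + (- 1 - y) = - (1 - - (x + y) - b) by lia.
  have -> : - x - b + (- 1 - y) = - (1 - - (x + y) + b) by lia.
  have -> : x + c + y = - (- (x + y) - c) by lia.
  have -> : x - c + y = - (- (x + y) + c) by lia.
  have -> : - x + c + y = - (x - y - c) by lia.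
  have -> : - x - c + y = - (x - y + c) by lia.
  rewrite !loss_atN1 !sgN !nulN.
  have := edge_loss_ge0 (- (x + y)) hb hc; have := edge_loss_ge0 (x - y) hb hc.
  by rewrite /edge_loss; lra.
by rewrite !(loss_far _ h); lra.
Qed.

(** The counts [b] and [c] are at most 1 here: longer walks would spread the two sign
differences in [edge_loss] unequally, and their sum could become negative. *)
Lemma triple_term_remove p q r (b c : bool) :
  triple_term p q r 1 b c <= triple_term p q r 0 b c.
Proof.
have -> : triple_term p q r 1 b c = triple_term p q r 0 b c -
    ((pair_term r q (p + b) - pair_term r q.+1 (p + b)) +
     (pair_term q r (p + c) - pair_term q r.+1 (p + c))).
  by rewrite /triple_term !addn0 !addn1; ring.
rewrite gerBl !pair_term_loss (walk3_swap23 p r q) -walk3D.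
apply: walk3_ge0_sym => x y z; rewrite (addrC z y).
by apply: (@loss_sym_ge0 b%:Z c%:Z); case: b c => [] [].
Qed.

Lemma triple_term_parity p q r a b c : triple_term p q r a b c <= triple_term p q r (odd a) b c.
Proof.
rewrite -{1}(odd_double_half a); elim: (a./2) => [|k IH]; first by rewrite addn0.
by rewrite doubleS !addnS (le_trans _ IH) ?triple_term_add2.
Qed.

Lemma triple_term_reduce p q r a (b c : bool) : triple_term p q r a b c <= triple_term p q r 0 b c.
Proof.
by apply: (le_trans (triple_term_parity _ _ _ _ _ _)); case: (odd a); rewrite ?triple_term_remove.
Qed.

(** Each of the three counts is first reduced to its parity, because the removal of single
coordinates applies only to counts that are at most 1. *)
Lemma triple_term_le1 p q r a b c : triple_term p q r a b c <= 1.
Proof.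
(* The swaps bring each of the three kinds of coordinates to the first place in turn. *)
apply: (le_trans (triple_term_parity _ _ _ _ _ _)).
rewrite triple_term_swap12; apply: (le_trans (triple_term_parity _ _ _ _ _ _)).
rewrite triple_term_swap12 triple_term_swap23 triple_term_swap12.
apply: (le_trans (triple_term_reduce _ _ _ _ _ _)).
rewrite triple_term_swap12; apply: (le_trans (triple_term_reduce _ _ _ _ false _)).
rewrite triple_term_swap12 triple_term_swap23 triple_term_swap12.
apply: (le_trans (triple_term_reduce _ _ _ _ false false)).
by rewrite triple_term000.
Qed.

(** * A coordinate where all three opponents differ *)

Definition shift3 (d x y z : int) : rat :=
  tau (y + z + d) (x + z + d) + tau (y + z + d) (x + y + d) + tau (x + z + d) (x + y + d).

(** Change of [tau3] when all three leads receive the same additional step. *)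
Definition gain (x y z : int) : rat :=
  (shift3 1 x y z + shift3 (-1) x y z) / 2 - tau3 x y z.

Lemma gain_swap12 x y z : gain x y z = gain y x z.
Proof.
have e d : shift3 d x y z = shift3 d y x z.
  by rewrite /shift3 tauC (addrC x y) addrAC.
have e0 : tau3 x y z = tau3 y x z.
  by rewrite /tau3 tauC (addrC x y) addrAC.
by rewrite /gain !e e0.
Qed.

Lemma gain_swap23 x y z : gain x y z = gain x z y.
Proof.
have e d : shift3 d x y z = shift3 d x z y.
  rewrite /shift3 (addrC y z) [in RHS](tauC (x + y + d)).
  by rewrite [tau (z + y + d) (x + z + d) + _]addrC.
have e0 : tau3 x y z = tau3 x z y.
  by rewrite /tau3 (addrC y z) [in RHS](tauC (x + y)) [tau (z + y) (x + z) + _]addrC.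
by rewrite /gain !e e0.
Qed.

Lemma gain_opp x y z : gain (- x) (- y) (- z) = gain x y z.
Proof.
have n (u v d : int) : - u + - v + d = - (u + v + - d) by lia.
rewrite /gain /shift3 /tau3 !n -!opprD !tauN opprK.
by rewrite [X in X / 2]addrC.
Qed.

Lemma signsum_gain_swap12 x y z : signsum gain x y z = signsum gain y x z.
Proof.
rewrite /signsum !(gain_swap12 _ y) (gain_swap12 _ (- y)) (gain_swap12 (- x) (-y)).
by rewrite [_ + gain (- y) x z]addrAC.
Qed.

Lemma signsum_gain_swap23 x y z : signsum gain x y z = signsum gain x z y.
Proof.
have e u v : gain u (- v) z = gain (- u) v (- z) by rewrite -gain_opp opprK.
rewrite /signsum !e opprK (gain_swap23 x y z) (gain_swap23 (- x) y z).
rewrite (gain_swap23 (- x) y (- z)) (gain_swap23 x y (- z)).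
exact: addrAC.
Qed.

Lemma signsum_gain_opp x y z : signsum gain (- x) y z = signsum gain x y z.
Proof. rewrite /signsum opprK; ring. Qed.

(** Sorting the walks leaves few chambers of the hyperplane arrangement to inspect; the
symmetries of [signsum gain] give the rest. *)
Lemma signsum_gain_sorted x y z : 0 <= z -> z <= y -> y <= x -> 0 <= signsum gain x y z.
Proof.
move=> z0 zy yx.
rewrite /signsum /gain /shift3 /tau3 /tau.
by signs; lra.
Qed.

Lemma signsum_gain_ge0 x y z : 0 <= signsum gain x y z.
Proof.
wlog x0 : x / 0 <= x => [h|].
  have [x0|x0] := lerP 0 x; first exact: h.
  by rewrite -signsum_gain_opp h //; lia.
wlog y0 : x x0 y / 0 <= y => [h|].
  have [y0|y0] := lerP 0 y; first exact: h.
  by rewrite signsum_gain_swap12 -signsum_gain_opp -signsum_gain_swap12 h //; lia.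
wlog z0 : x x0 y y0 z / 0 <= z => [h|].
  have [z0|z0] := lerP 0 z; first exact: h.
  rewrite signsum_gain_swap23 signsum_gain_swap12 -signsum_gain_opp.
  by rewrite -signsum_gain_swap12 -signsum_gain_swap23 h //; lia.
wlog yx : x x0 y y0 / y <= x => [h|].
  have [yx|yx] := lerP y x; first exact: h.
  by rewrite signsum_gain_swap12 h // ltW.
have [zy|/ltW zy] := lerP z y; first exact: signsum_gain_sorted.
rewrite signsum_gain_swap23.
have [zx|/ltW zx] := lerP z x; first exact: signsum_gain_sorted.
by rewrite signsum_gain_swap12; apply: signsum_gain_sorted.
Qed.

(** A walk of length [n] reaches the parity of [n], so these points are attained with
positive probability, which makes the inequality below strict. *)
Lemma signsum_gain_unit (x y z : bool) : 1 <= signsum gain x%:Z y%:Z z%:Z.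
Proof.
by rewrite /signsum /gain /shift3 /tau3 /tau; case: x y z => [] [] []; vm_compute.
Qed.

Lemma pair_term_succ p q r : pair_term r.+1 q p = walk3 p q r (fun x y z =>
  (tau (y + z + 1) (x + z + 1) + tau (y + z + -1) (x + z + -1)) / 2).
Proof. by rewrite pair_term_walk3 walk3S3; apply: eq_walk3 => x y z; rewrite !addrA. Qed.

Lemma triple_term_succ_gt1 p q r :
  1 < pair_term r.+1 q p + pair_term q.+1 r p + pair_term p.+1 r q.
Proof.
have e : pair_term r.+1 q p + pair_term q.+1 r p + pair_term p.+1 r q =
    walk3 p q r gain + triple_term p q r 0 0 0.
  rewrite triple_term_walk3 -walk3D !pair_term_succ (walk3_swap23 p r q).
  rewrite (walk3_swap12 q r p) (walk3_swap23 r q p) (walk3_swap12 r p q) (walk3_swap23 p r q).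
  rewrite -2!walk3D; apply: eq_walk3 => x y z; rewrite /gain /shift3 subrK.
  rewrite (addrC z y) (addrC y x) (addrC z x).
  by lra.
rewrite e triple_term000 ltrDr.
suff : 0 < 4 * walk3 p q r gain by lra.
rewrite -walk3_signsum.
(* Strictness: the integrand dominates the indicator of one reachable point. *)
pose m x y z := nul ((odd p)%:Z - x) * (nul ((odd q)%:Z - y) * nul ((odd r)%:Z - z)).
have m0 : 0 < walk3 p q r m.
  have -> : walk3 p q r m = mass p (odd p) * (mass q (odd q) * mass r (odd r)).
    exact: walk3_mul.
  by rewrite !mulr_gt0 ?mass_odd_gt0.
apply: (lt_le_trans m0); rewrite -subr_ge0 -[X in _ - X]mul1r -mulNr -walk3_lin.
apply: walk3_ge0 => x y z; rewrite mulN1r subr_ge0 /m.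
have g := signsum_gain_ge0 x y z.
case: (signP (_ - x)) => [_|hx|_]; rewrite ?mul0r // mul1r.
case: (signP (_ - y)) => [_|hy|_]; rewrite ?mul0r // mul1r.
case: (signP (_ - z)) => [_|hz|_] //.
have -> : x = odd p by lia. have -> : y = odd q by lia. have -> : z = odd r by lia.
exact: le_trans (signsum_gain_unit _ _ _).
Qed.

(** * Averages over the cube as walks *)

Definition mean n (F : cube n -> rat) : rat := 2 ^- n * \sum_x F x.

(** A coordinate of the translated voter is [false] where the voter agrees with the player,
which is a point for the player against an opponent who differs there. *)
Definition step (b : bool) : int := if b then -1 else 1.

Lemma sum_cubeS n (F : cube n.+1 -> rat) :
  \sum_x F x = \sum_(b : bool) \sum_(g : cube n)
    F [ffun i => if unlift ord0 i is Some j then g j else b].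
Proof.
rewrite pair_big /=.
pose h (u : bool * cube n) : cube n.+1 :=
  [ffun i => if unlift ord0 i is Some j then u.2 j else u.1].
pose k (f : cube n.+1) : bool * cube n := (f ord0, [ffun j => f (lift ord0 j)]).
have hk : cancel k h.
  move=> f; apply/ffunP => i; rewrite ffunE /=.
  by case: unliftP => [j|] ->; rewrite ?ffunE.
have kh : cancel h k.
  move=> [b g]; congr (_, _); first by rewrite ffunE unlift_none.
  by apply/ffunP => j; rewrite !ffunE liftK.
by rewrite (reindex h) //; exists k => u _; [apply: kh|apply: hk].
Qed.

Lemma mean_walk3 n (u v : 'I_n -> bool) (F : int -> int -> rat) :
  mean (fun e : cube n => F (\sum_j (u j)%:Z * step (e j)) (\sum_j (v j)%:Z * step (e j)))
  = walk3 (\sum_j (u j && v j)) (\sum_j (u j && ~~ v j)) (\sum_j (~~ u j && v j))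
     (fun x y z => F (x + y) (x + z)).
Proof.
rewrite /mean; elim: n u v F => [|n IH] u v F.
  rewrite expr0 invr1 mul1r (big_pred1 [ffun => false]) ?big_ord0 //.
  by move=> x; symmetry; apply/eqP/ffunP => -[].
rewrite sum_cubeS big_bool /=.
have e b (w : 'I_n.+1 -> bool) (g : cube n) :
  \sum_j (w j)%:Z * step ([ffun i => if unlift ord0 i is Some j then g j else b] j) =
  (w ord0)%:Z * step b + \sum_j (w (lift ord0 j))%:Z * step (g j).
  rewrite big_ord_recl ffunE unlift_none; congr (_ + _).
  by apply: eq_bigr => j _; rewrite ffunE liftK.
under eq_bigr do rewrite !e.
under [in X in _ * (_ + X)]eq_bigr do rewrite !e.
rewrite exprS invfM.
set A := \sum_g _; set B := \sum_g _.
have -> : 2^-1 * 2 ^- n * (A + B) = (2 ^- n * A + 2 ^- n * B) / 2 by ring.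
rewrite /A /B {A B}.
rewrite (IH _ _ (fun x y => F ((u ord0)%:Z * step true + x) ((v ord0)%:Z * step true + y))).
rewrite (IH _ _ (fun x y => F ((u ord0)%:Z * step false + x) ((v ord0)%:Z * step false + y))).
rewrite !big_ord_recl.
case: (u ord0); case: (v ord0);
  rewrite /= ?mul1r ?mul0r ?add0n ?add1n ?(walk3S1, walk3S2, walk3S3) walk3_avg;
  apply: eq_walk3 => x y z.
- by rewrite addrC; congr ((F _ _ + F _ _) / 2); lia.
- by rewrite addrC; congr ((F _ _ + F _ _) / 2); lia.
- by rewrite addrC; congr ((F _ _ + F _ _) / 2); lia.
- by rewrite !add0r; field.
Qed.

Lemma eq_mean n (F G : cube n -> rat) : F =1 G -> mean F = mean G.
Proof. by move=> e; congr (_ * _); apply: eq_bigr => x _; apply: e. Qed.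

Lemma meanD n (F G : cube n -> rat) : mean (fun x => F x + G x) = mean F + mean G.
Proof. by rewrite /mean big_split mulrDr. Qed.

Lemma meanZ n c (F : cube n -> rat) : mean (fun x => c * F x) = c * mean F.
Proof. by rewrite /mean -big_distrr mulrCA. Qed.

Lemma mean_const n c : mean (fun _ : cube n => c) = c.
Proof.
rewrite /mean sumr_const card_ffun card_bool card_ord -[c *+ _]mulr_natl natrX.
by rewrite mulKf // expf_neq0.
Qed.

Definition translate n (y x : cube n) : cube n := [ffun j => x j (+) y j].

Lemma mean_translate n (y : cube n) (F : cube n -> rat) :
  mean (fun x => F (translate y x)) = mean F.
Proof.
rewrite /mean [in RHS](reindex (translate y)) //.
have tK : cancel (translate y) (translate y).
  by move=> x; apply/ffunP => j; rewrite !ffunE addbK.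
by exists (translate y) => x _; apply: tK.
Qed.

(** How much closer the player at [y] is than the opponent at [a] to a voter given by
its difference [e] with [y]. *)
Definition lead n (y a e : cube n) : int := \sum_j (a j != y j)%:Z * step (e j).

Lemma lead_opp n (y a e : cube n) :
  lead y a (translate [ffun=> true] e) = - lead y a e.
Proof.
rewrite /lead -sumrN; apply: eq_bigr => j _.
by rewrite !ffunE; case: (e j); rewrite /= ?mulrN ?opprK.
Qed.

Lemma hamming_lead n (x y a : cube n) :
  (hamming (translate y x) a)%:Z - (hamming (translate y x) y)%:Z = lead y a x.
Proof.
rewrite /hamming !(big_morph Posz PoszD (erefl _)) -sumrB; apply: eq_bigr => j _.
by rewrite ffunE; case: (x j) (y j) (a j) => [] [] [].
Qed.

(** * The score formula *)

Definition share (x y z : int) : rat :=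
  if [&& 0 <= x, 0 <= y & 0 <= z] then 1 / (1 + nul x + nul y + nul z) else 0.

(** Let s be the indicator of the positive half-line with value 1/2 at 0.  In
s(x)s(y)s(z) + s(-x)s(-y)s(-z) the cubic terms cancel, because s(-x) = 1 - s(x),
and only products of two signs remain.  The true share differs from s(x)s(y)s(z)
when two leads vanish and the third is positive, by 1/12, and when all three vanish,
by 1/8 in each of the two terms: in total 1/12 for each vanishing pair of leads. *)
Lemma share_sym x y z : share x y z + share (- x) (- y) (- z) =
  1 / 4 + (tau x y + tau x z + tau y z) / 4.
Proof.
rewrite /share !nulN !oppr_ge0 /tau.
case: (signP x) => hx; case: (signP y) => hy; case: (signP z) => hz.
all: do 2 (case: ifP => ?); try (exfalso; lia); by field.
Qed.

Definition cube_pair_term n (y a b : cube n) : rat :=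
  pair_term (\sum_j ((a j != y j) && (b j != y j))) (\sum_j ((a j != y j) && ~~ (b j != y j)))
    (\sum_j (~~ (a j != y j) && (b j != y j))).

Lemma mean_tau n (y a b : cube n) :
  mean (fun e => tau (lead y a e) (lead y b e)) = cube_pair_term y a b.
Proof. exact: mean_walk3. Qed.

Lemma mean_share n (y a b c : cube n) :
  mean (fun e => share (lead y a e) (lead y b e) (lead y c e)) =
  1 / 8 + (cube_pair_term y a b + cube_pair_term y a c + cube_pair_term y b c) / 8.
Proof.
set m := mean _.
suff : m + m = 1 / 4 +
    1 / 4 * (cube_pair_term y a b + cube_pair_term y a c + cube_pair_term y b c) by lra.
rewrite {2}/m -(mean_translate [ffun=> true]) -meanD.
rewrite -!mean_tau -!meanD -meanZ -[X in _ = X + _](mean_const n) -meanD.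
apply: eq_mean => e; rewrite !lead_opp share_sym; lra.
Qed.

Definition o0 : 'I_3 := ord0.
Definition o1 : 'I_3 := lift ord0 ord0.
Definition o2 : 'I_3 := lift ord0 (lift ord0 ord0).

Lemma ord3P (j : 'I_3) : [\/ j = o0, j = o1 | j = o2].
Proof.
by case: j => [[|[|[|//]]] h]; [apply: Or31|apply: Or32|apply: Or33]; apply: val_inj.
Qed.

Lemma forall_ord4 (i : 'I_4) (Q : pred 'I_4) : Q i ->
  [forall k, Q k] = [&& Q (lift i o0), Q (lift i o1) & Q (lift i o2)].
Proof.
move=> Qi; apply/forallP/and3P => [h|[h0 h1 h2] k]; first by split.
by case: (unliftP i k) => [j|] -> //; case: (ord3P j) => ->.
Qed.

Lemma sum_ord4 (i : 'I_4) (R : nmodType) (F : 'I_4 -> R) :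
  \sum_k F k = F i + (F (lift i o0) + (F (lift i o1) + F (lift i o2))).
Proof. by rewrite (bigD1_ord i) //= !big_ord_recl big_ord0 addr0. Qed.

(** The lead in terms of the voter itself; [lead] takes the voter's difference with the
player, which makes the coordinates that matter independent of the player's position. *)
Definition gap n (P : profile n) (i k : 'I_4) (x : cube n) : int :=
  (hamming x (P k))%:Z - (hamming x (P i))%:Z.

Lemma claims_gap n (P : profile n) i x : claims P i x =
  [&& 0 <= gap P i (lift i o0) x, 0 <= gap P i (lift i o1) x
    & 0 <= gap P i (lift i o2) x].
Proof.
rewrite /claims (forall_ord4 (i := i) (Q := fun k => _ <= _)%N) //.
by rewrite /gap !subr_ge0.
Qed.

Lemma claims_tie n (P : profile n) i k x :
  claims P i x -> claims P k x = (gap P i k x == 0).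
Proof.
rewrite /gap subr_eq0 => /forallP ci; apply/forallP/eqP => [ck|[e] l].
  by have := ci k; have := ck i; lia.
by rewrite e.
Qed.

Lemma score_share n (P : profile n) i : score P i =
  mean (fun x => share (gap P i (lift i o0) x) (gap P i (lift i o1) x)
                       (gap P i (lift i o2) x)).
Proof.
rewrite /score /mean big_mkcond; congr (_ * _); apply: eq_bigr => x _.
rewrite inE /share -claims_gap; case: ifP => // ci; congr (1 / _).
rewrite /num_claims cardsE -sum1_card natr_sum big_mkcond (sum_ord4 i) /=.
have e k : (if k \in claims P ^~ x then 1%:R else 0) = (claims P k x)%:R :> rat.
  by rewrite unfold_in; case: (claims _ _ _).
by rewrite !e ci !(claims_tie _ ci) !addrA.
Qed.

Lemma score_cube_pair_term n (P : profile n) i :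
  score P i = 1 / 8 + (cube_pair_term (P i) (P (lift i o0)) (P (lift i o1)) +
    cube_pair_term (P i) (P (lift i o0)) (P (lift i o2)) +
    cube_pair_term (P i) (P (lift i o1)) (P (lift i o2))) / 8.
Proof.
rewrite score_share -mean_share -(mean_translate (P i)).
by apply: eq_mean => x; rewrite /gap !hamming_lead.
Qed.

Lemma sum_score n (P : profile n) : \sum_i score P i = 1.
Proof.
rewrite /score -big_distrr /= -[RHS](mean_const n); congr (_ * _).
under eq_bigr do rewrite big_mkcond.
rewrite exchange_big /=; apply: eq_bigr => x _.
under eq_bigr do rewrite inE.
rewrite -big_mkcond sumr_const -[LHS]mulr_natr div1r {1}/num_claims cardsE.
rewrite mulVf // pnatr_eq0 -lt0n.
(* A player closest to the voter claims it. *)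
apply/card_gt0P.
case: (arg_minnP (fun k => hamming x (P k)) (i0 := ord0) (P := predT)) => // i _ hi.
by exists i; apply/forallP => k; apply: hi.
Qed.

(** * Equilibria and balanced profiles *)

Definition type_count n (y a b c : cube n) (s : bool * bool * bool) : nat :=
  \sum_j ((a j != y j, b j != y j, c j != y j) == s).

Lemma sum_cube_pair_term n (y a b c : cube n) : let N := type_count y a b c in
  cube_pair_term y a b + cube_pair_term y a c + cube_pair_term y b c =
  pair_term (N (true, true, false) + N (true, true, true))
        (N (true, false, true) + N (true, false, false))
        (N (false, true, true) + N (false, true, false)) +
  pair_term (N (true, false, true) + N (true, true, true))
        (N (true, true, false) + N (true, false, false))
        (N (false, true, true) + N (false, false, true)) +
  pair_term (N (false, true, true) + N (true, true, true))
        (N (true, true, false) + N (false, true, false))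
        (N (true, false, true) + N (false, false, true)).
Proof.
rewrite /= /type_count -!big_split /=.
congr (_ + _ + _); congr pair_term; apply: eq_bigr => j _;
  by case: (a j != y j) (b j != y j) (c j != y j) => [] [] [].
Qed.

Lemma type_count0 n (y a b c : cube n) s :
  (forall j, (a j != y j, b j != y j, c j != y j) != s) -> type_count y a b c s = 0.
Proof. by move=> h; rewrite /type_count big1 // => j _; rewrite (negbTE (h j)). Qed.

Lemma card_zeros n (P : profile n) (i : 'I_4) j :
  #|[set k : 'I_4 | P k j == false]| =
  (~~ P i j + (~~ P (lift i o0) j + (~~ P (lift i o1) j + ~~ P (lift i o2) j)))%N.
Proof.
rewrite cardsE -sum1_card big_mkcond (sum_ord4 i) /= !unfold_in /=.
by do 4 case: (P _ j).
Qed.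

Definition agree n (P : profile n) (i : 'I_4) j : bool :=
  (P (lift i o0) j == P (lift i o1) j) && (P (lift i o1) j == P (lift i o2) j).

(** No coordinate is of the type where all three opponents differ from the player, so
[triple_term_le1] applies; coordinates where all agree do not enter. *)
Lemma score_covering n (P : profile n) (i : 'I_4) :
  (forall j, ~~ agree P i j) ->
  score P i <= 1 / 4.
Proof.
move=> cov; rewrite score_cube_pair_term sum_cube_pair_term.
set N := type_count _ _ _ _.
have -> : N (true, true, true) = 0.
  apply: type_count0 => j; move: (cov j); rewrite /agree.
  by case: (P i j) (P _ j) (P _ j) (P _ j) => [] [] [] [].
rewrite !addn0 -/(triple_term _ _ _ _ _ _).
have := triple_term_le1 (N (false, true, true)) (N (true, false, true)) (N (true, true, false))
  (N (true, false, false)) (N (false, true, false)) (N (false, false, true)).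
lra.
Qed.

(** In every coordinate the player agrees with exactly one opponent, so this is the
situation of [triple_term000]. *)
Lemma score_balanced n (P : profile n) (i : 'I_4) : balanced P -> score P i = 1 / 4.
Proof.
move=> bal; rewrite score_cube_pair_term sum_cube_pair_term.
have N0 s : s \notin [:: (true, true, false); (true, false, true); (false, true, true)] ->
    type_count (P i) (P (lift i o0)) (P (lift i o1)) (P (lift i o2)) s = 0.
  move=> hs; apply: type_count0 => j; apply: contra hs => /eqP <-.
  move: (bal j); rewrite (card_zeros P i).
  by case: (P i j) (P (lift i o0) j) (P (lift i o1) j) (P (lift i o2) j) => [] [] [] [].
set N := type_count _ _ _ _ in N0 *.
rewrite !(N0 (true, true, true)) // !(N0 (true, false, false)) //.
rewrite !(N0 (false, true, false)) // !(N0 (false, false, true)) // !addn0.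
have := triple_term000 (N (false, true, true)) (N (true, false, true)) (N (true, true, false)).
rewrite /triple_term !addn0; lra.
Qed.

Definition minority (a b c : bool) : bool := if a (+) b then ~~ c else ~~ a.

(** The deviation of player [i] that takes the minority value against the three opponents,
except that on unanimous coordinates other than [j0] it joins them: those then become
irrelevant to everybody, and at most one coordinate remains where all opponents differ,
the only situation that [triple_term_succ_gt1] covers. *)
Definition counter n (P : profile n) (j0 : 'I_n) (i : 'I_4) : profile n :=
  [ffun k => if k == i then
     [ffun j => minority (P (lift i o0) j) (P (lift i o1) j) (P (lift i o2) j)
                (+) (agree P i j && (j != j0))] else P k].

Lemma score_counter n (P : profile n) j0 i :
  if agree P i j0 then 1 / 4 < score (counter P j0 i) i
  else 1 / 4 <= score (counter P j0 i) i.
Proof.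
have el k : counter P j0 i (lift i k) = P (lift i k).
  by rewrite ffunE eq_sym (negbTE (neq_lift i k)).
rewrite score_cube_pair_term sum_cube_pair_term !el [counter P j0 i i]ffunE eqxx.
set y : cube n := [ffun j => _].
set N := type_count _ _ _ _.
have N100 : N (true, false, false) = 0.
  apply: type_count0 => j; rewrite ffunE /agree /minority.
  by case: (P _ j) (P _ j) (P _ j) (j != j0) => [] [] [] [].
have N010 : N (false, true, false) = 0.
  apply: type_count0 => j; rewrite ffunE /agree /minority.
  by case: (P _ j) (P _ j) (P _ j) (j != j0) => [] [] [] [].
have N001 : N (false, false, true) = 0.
  apply: type_count0 => j; rewrite ffunE /agree /minority.
  by case: (P _ j) (P _ j) (P _ j) (j != j0) => [] [] [] [].
have N111 : N (true, true, true) = agree P i j0.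
  rewrite /N /type_count (bigD1 j0) //= big1 => [|j jj0]; rewrite !ffunE /agree /minority.
    rewrite eqxx andbF addbF addn0.
    by case: (P _ j0) (P _ j0) (P _ j0) => [] [] [].
  by rewrite jj0 andbT; case: (P _ j) (P _ j) (P _ j) => [] [] [].
rewrite N100 N010 N001 N111 !addn0; case: (agree P i j0); rewrite ?addn1 ?addn0.
  have := triple_term_succ_gt1
    (N (false, true, true)) (N (true, false, true)) (N (true, true, false)).
  lra.
have := triple_term000 (N (false, true, true)) (N (true, false, true)) (N (true, true, false)).
rewrite /triple_term !addn0; lra.
Qed.

(** With [z] zeros in the coordinate, the opponents of [i] are unanimous iff [z] minus the
contribution of [i] is 0 or 3; for [z] different from 2, some player (the one in the
minority, or anyone if all four agree) satisfies this. *)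
Lemma unbalanced_agree n (P : profile n) j :
  #|[set i : 'I_4 | P i j == false]| <> 2 -> exists i, agree P i j.
Proof.
(* By contradiction: otherwise the number of zeros minus any player's contribution
   avoids 0 and 3, which leaves 2 as the only possible number. *)
move=> Z2; apply/existsP; rewrite -[X in is_true X]negbK; apply/existsPn => h; apply: Z2.
set A := [set _ | _].
have hA i : (#|A| - (i \in A))%N \notin [:: 0; 3]%N.
  move: (h i); rewrite /A (card_zeros P i) inE /agree.
  by case: (P i j) (P (lift i o0) j) (P (lift i o1) j) (P (lift i o2) j) => [] [] [] [].
have le4 : (#|A| <= 4)%N by rewrite -[X in (_ <= X)%N](card_ord 4) max_card.
have [A0|A0] := posnP #|A|; first by have := hA ord0; rewrite A0 sub0n.
have [A4|A4] := boolP (A == setT).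
  by have := hA ord0; rewrite (eqP A4) cardsT card_ord in_setT.
have [i iA] := card_gt0P A0; have := hA i; rewrite iA.
have [k kA] : exists k, k \notin A.
  by move: A4; rewrite -subTset => /subsetPn [k _ kA]; exists k.
have := hA k; rewrite (negbTE kA).
by case: #|A| le4 A0 => [|[|[|[|[|]]]]].
Qed.

Theorem theorem1p2 (n : nat) (hn : (0 < n)%N) (P : profile n) :
  equilibrium P <-> balanced P.
Proof.
split=> [eq j|bal i P' hP'].
  apply/eqP; apply: contraT => /eqP /unbalanced_agree [i0 agr].
  have dev i : score (counter P j i) i <= score P i.
    by apply: eq => k ki; rewrite ffunE (negbTE ki).
  have ge i : 1 / 4 <= score P i.
    have := dev i; have := score_counter P j i; case: ifP => _; lra.
  have gt : 1 / 4 < score P i0.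
    have := dev i0; have := score_counter P j i0; rewrite agr; lra.
  have := sum_score P; rewrite (sum_ord4 i0).
  have := ge (lift i0 o0); have := ge (lift i0 o1); have := ge (lift i0 o2); lra.
rewrite (score_balanced i bal); apply: score_covering => j.
rewrite /agree !hP' 1?eq_sym ?neq_lift //.
move: (bal j); rewrite (card_zeros P i).
by case: (P i j) (P (lift i o0) j) (P (lift i o1) j) (P (lift i o2) j) => [] [] [] [].
Qed.
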